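(* Let $k_1,k_2\ge 1$ be integers and let $N_1,N_2\ge 1$ be odd square-free integers. Let $f=\sum_{n\ge1}a(n)q^n\in S^{\mathrm{new}}_{k_1+\frac12}(4N_1,\chi_0)$ and $g=\sum_{n\ge1}b(n)q^n\in S^{\mathrm{new}}_{k_2+\frac12}(4N_2,\chi_0)$ be two distinct non-zero cuspidal eigenforms for the operators $T_{p^2}$ for all primes $p\nmid 2N_1$, respectively $p\nmid 2N_2$, where $\chi_0$ is the trivial character, and let $t\ge1$ be a square-free integer with $a(t)=b(t)=1$. Suppose that the Shimura lifts $F=\sum_{n\ge1} A(n)q^n\in S^{\mathrm{new}}_{2k_1}(2N_1)$ of $f$ and $G=\sum_{n\ge1} B(n)q^n\in S^{\mathrm{new}}_{2k_2}(2N_2)$ of $g$ with respect to $t$ are cuspidal eigenforms for the operators $T_p$ for all primes $p\nmid 2N_1$, respectively $p\nmid 2N_2$ (they are then primitive forms). Assume that $F$ and $G$ are not twists of each other and that the pair Sato–Tate conjecture holds for $(F,G)$. Then for any two subintervals $I_1,I_2\subseteq[-1,1]$, the set $$S(I_1,I_2)=\left\{p\text{ prime}:\ p\nmid 4N_1N_2,\ \frac{a(tp^2)}{2p^{k_1-\frac12}}\in I_1,\ \frac{b(tp^2)}{2p^{k_2-\frac12}}\in I_2\right\}$$ has a natural density, and $$d(S(I_1,I_2))=\lim_{x\to\infty}\frac{\#\{p\le x:\ p\in S(I_1,I_2)\}}{\pi(x)}=\mu_{\mathrm{ST}}(I_1)\,\mu_{\mathrm{ST}}(I_2).$$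
   Context: For a natural number $k$ and an odd square-free $N\ge1$, $S_{k+\frac12}(4N,\chi_0)$ is the space of cusp forms of weight $k+\frac12$ and level $4N$ with trivial character; when $k=1$ one works only with the orthogonal complement (for the Petersson inner product) of the subspace spanned by single-variable unary theta functions. $S^{+}_{k+\frac12}(4N,\chi_0)$ is Kohnen's plus subspace, consisting of the forms whose $n$-th Fourier coefficient vanishes for $n\equiv 2,(-1)^{k+1}\pmod 4$. $S^{\mathrm{new}}_{k+\frac12}(4N,\chi_0)$ is the space of newforms in the sense of Manickam–Ramakrishnan–Vasudevan: the Petersson-orthogonal complement in $S_{k+\frac12}(4N,\chi_0)$ of the old space spanned by $S_{k+\frac12}(4N/p,\chi_0)$ and $S_{k+\frac12}(4N/p,\chi_0)|U(p^2)$ for primes $p\mid N$, together with $S^+_{k+\frac12}(4N,\chi_0)$ and $S^+_{k+\frac12}(4N,\chi_0)|U(4)$, where $U(m)$ sends $\sum a(n)q^n$ to $\sum a(mn)q^n$. $S^{\mathrm{new}}_{2k}(2N)$ is the usual space of newforms of weight $2k$ and level $\Gamma_0(2N)$ with trivial character; a primitive form is a normalized newform (Hecke eigenform with first coefficient $1$). $T_{p^2}$ and $T_p$ are the usual Hecke operators in half-integral and integral weight. The Shimura lift of $f$ with respect to the square-free integer $t$ is $F=\sum_{n\ge1}A(n)q^n$ with $A(n)=\sum_{d\mid n,\ (d,2N_1)=1}\chi_1(d)\,d^{k_1-1}a\!\left(\frac{tn^2}{d^2}\right)$, where $\chi_1$ is the quadratic character $d\mapsto\left(\frac{(-1)^{k_1}t}{d}\right)$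 on $d$ prime to $2N_1$; $G=\sum_{n\ge 1} B(n)q^n$ is defined in the same way from $g$ with $k_2,N_2$. The numbers $A(n),B(n)$, and hence $a(tp^2),b(tp^2)$ for primes $p$, are real. ''Not twists of each other'' means that neither form is the twist of the other by a Dirichlet character. The Sato–Tate measure $\mu_{\mathrm{ST}}$ is the probability measure $\frac{2}{\pi}\sqrt{1-u^2}\,du$ on $[-1,1]$. The natural density of a set $S$ of primes is $d(S)=\lim_{x\to\infty}\frac{\#\{p\le x:\ p\in S\}}{\pi(x)}$, where $\pi(x)$ is the number of primes $\le x$. The pair Sato–Tate conjecture for $(F,G)$ is the statement that for any two subintervals $J_1,J_2\subseteq[-1,1]$ the set of primes $p\nmid 2N_1N_2$ with $\frac{A(p)}{2p^{k_1-\frac12}}\in J_1$ and $\frac{B(p)}{2p^{k_2-\frac12}}\in J_2$ has natural density $\mu_{\mathrm{ST}}(J_1)\mu_{\mathrm{ST}}(J_2)$. *)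

(* Defs.v *)
From HB Require Import structures.
From mathcomp Require Import all_boot all_order all_algebra.
From mathcomp Require Import all_classical all_reals all_analysis.
From mathcomp Require Import complex.

Set Implicit Arguments.
Unset Strict Implicit.
Unset Printing Implicit Defensive.

Import Order.TTheory GRing.Theory Num.Theory numFieldNormedType.Exports.

Local Open Scope classical_set_scope.
Local Open Scope complex_scope.
Local Open Scope ring_scope.

Definition square_free (n : nat) : Prop :=
  (0 < n)%N /\ forall p : nat, prime p -> ~~ (p ^ 2 %| n)%N.

(* Only meaningful when p is an odd prime. *)
Definition legendre (a : int) (p : nat) : int :=
  if (p%:Z %| a)%Z then 0
  else if [exists x : 'I_p, (x%:Z ^+ 2 == a %[mod p%:Z])%Z] then 1 else -1.

(* Only meaningful when d is odd. *)
Definition jacobi (a : int) (d : nat) : int :=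
  \prod_(p <- primes d) legendre a p ^+ logn p d.

(* Nonvanishing at 1 and multiplicativity force chi 1 = 1. *)
Definition dirichlet_character (R : realType) (m : nat) (chi : int -> R[i]) :=
  [/\ (0 < m)%N,
      forall x, chi (x + m%:Z) = chi x,
      forall x y, chi (x * y) = chi x * chi y &
      forall x, (chi x != 0) = coprimez x m%:Z].

(* A form is a function R[i] -> R[i]; only its values on the upper half-plane
   matter.  The regular module R[i]^o carries the topology of R[i]. *)

Definition upper (R : realType) : {pred R[i]} := fun z => 0 < complex.Im z.
Arguments upper {R}.

Definition holomorphic_upper (R : realType) (f : R[i] -> R[i]) :=
  forall z, z \in upper -> derivable (f : R[i]^o -> R[i]^o) z 1.

Definition cvgC (R : realType) (u : nat -> R[i]) (l : R[i]) : Prop :=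
  (u : nat -> R[i]^o) @ \oo --> (l : R[i]^o).

Definition limC (R : realType) (u : nat -> R[i]) : R[i] :=
  lim ((u : nat -> R[i]^o) @ \oo).

Definition cexp (R : realType) (z : R[i]) : R[i] :=
  (expR (complex.Re z))%:C * (cos (complex.Im z) +i* sin (complex.Im z)).

Definition q (R : realType) (z : R[i]) : R[i] := cexp ((2 * pi)%:C * 'i * z).

Definition q_expansion (R : realType) (a : nat -> R[i]) (f : R[i] -> R[i]) :=
  forall z, z \in upper ->
    cvgC (fun m => \sum_(1 <= n < m) a n * q z ^+ n) (f z).

Definition span (R : realType) (A : set (R[i] -> R[i])) : set (R[i] -> R[i]) :=
  [set h | exists n (c : 'I_n -> R[i]) (u : 'I_n -> R[i] -> R[i]),
     (forall i, A (u i)) /\ h = fun z => \sum_(i < n) c i * u i z].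

(* V | U(m), where U(m) sends \sum a(n) q^n to \sum a(mn) q^n. *)
Definition image_U (R : realType) (m : nat) (V : set (R[i] -> R[i])) :
    set (R[i] -> R[i]) :=
  [set h | exists f a,
     [/\ V f, q_expansion a f & q_expansion (fun n => a (m * n)%N) h]].

Definition Gamma0 (M : nat) : set 'M[int]_2 :=
  [set g : 'M[int]_2 | \det g = 1 /\ (M%:Z %| g 1%R 0%R)%Z].

Definition denom (R : realType) (g : 'M[int]_2) (z : R[i]) : R[i] :=
  (g 1 0)%:~R * z + (g 1 1)%:~R.

Definition mobius (R : realType) (g : 'M[int]_2) (z : R[i]) : R[i] :=
  ((g 0 0)%:~R * z + (g 0 1)%:~R) / denom g z.

(* The slash operator of weight w / 2, up to the choice of the square root of
   c z + d, which is a branch holomorphic on the upper half-plane; for w even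
   this is the usual slash operator of integral weight. *)
Definition slash (R : realType) (w : nat) (f : R[i] -> R[i]) (g : 'M[int]_2)
    (z : R[i]) : R[i] :=
  (sqrtC (denom g z)) ^- w * f (mobius g z).

(* Every cusp is the image of infinity under some g in SL_2(Z). *)
Definition vanishes_at_cusps (R : realType) (w : nat) (f : R[i] -> R[i]) :=
  forall g : 'M[int]_2, \det g = 1 ->
  forall eps : R, 0 < eps -> exists Y : R, forall z,
    z \in upper -> Y < complex.Im z -> `|slash w f g z| < eps%:C.

(* Ford's fundamental domain for Gamma0(M): the points of maximal height in
   their orbit lying in the vertical strip of width 1.  Its boundary is a null
   set. *)
Definition ford_domain (R : realType) (M : nat) : set (R * R) :=
  [set xy | [/\ 0 < xy.2, `|xy.1| <= 2^-1 &
     forall g, Gamma0 M g ->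
       complex.Im (mobius g (xy.1 +i* xy.2)) <= xy.2]].
Arguments ford_domain : clear implicits.

Definition cintegral (R : realType) (D : set (R * R)) (F : R * R -> R[i]) :
    R[i] :=
  (\int[(lebesgue_measure \x lebesgue_measure)%E]_(xy in D)
      complex.Re (F xy))
  +i*
  (\int[(lebesgue_measure \x lebesgue_measure)%E]_(xy in D)
      complex.Im (F xy)).

(* The Petersson product of weight kappa on Gamma0(M), not normalized by the
   index of Gamma0(M), which is irrelevant to orthogonality. *)
Definition petersson (R : realType) (kappa : R) (M : nat)
    (f h : R[i] -> R[i]) : R[i] :=
  cintegral (ford_domain R M)
    (fun xy => let z := xy.1 +i* xy.2 in
       f z * conjc (h z) * (xy.2 `^ (kappa - 2))%:C).

Definition orth_compl (R : realType) (kappa : R) (M : nat)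
    (V W : set (R[i] -> R[i])) : set (R[i] -> R[i]) :=
  [set f | V f /\ forall h, W h -> petersson kappa M f h = 0].

Definition theta (R : realType) (z : R[i]) : R[i] :=
  1 + 2 * limC (fun m => \sum_(1 <= n < m) q z ^+ (n ^ 2)).

(* Shimura's automorphy factor (c/d) eps_d^{-1} (cz+d)^{1/2} on Gamma0(4). *)
Definition jfactor (R : realType) (g : 'M[int]_2) (z : R[i]) : R[i] :=
  theta (mobius g z) / theta z.

Definition cusp_half (R : realType) (k N : nat) : set (R[i] -> R[i]) :=
  [set f | [/\ holomorphic_upper f,
     forall g, Gamma0 (4 * N) g -> forall z, z \in upper ->
       f (mobius g z) = jfactor g z ^+ (2 * k).+1 * f z &
     vanishes_at_cusps (2 * k).+1 f]].
Arguments cusp_half : clear implicits.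

(* The theta functions \sum_(n >= 1) psi(n) n q^(t n^2), psi odd, of weight
   3/2, level 4N and trivial character. *)
Definition unary_theta (R : realType) (N : nat) : set (R[i] -> R[i]) :=
  [set h | cusp_half R 1 N h /\
     exists r (psi : int -> R[i]) t,
       [/\ dirichlet_character r psi, psi (-1) = -1, (0 < t)%N &
         forall z, z \in upper ->
           cvgC (fun m => \sum_(1 <= n < m) psi n%:Z * n%:R * q z ^+ (t * n ^ 2))
                (h z)]].
Arguments unary_theta : clear implicits.

Definition S_half (R : realType) (k N : nat) : set (R[i] -> R[i]) :=
  if k == 1%N
  then orth_compl (k%:R + 2^-1) (4 * N) (cusp_half R k N)
         (span (unary_theta R N))
  else cusp_half R k N.
Arguments S_half : clear implicits.

Definition S_plus (R : realType) (k N : nat) : set (R[i] -> R[i]) :=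
  [set f | S_half R k N f /\
     exists2 a, q_expansion a f &
       forall n, (0 < n)%N ->
         (n%:Z = 2 %[mod 4])%Z \/ (n%:Z = (-1) ^+ k.+1 %[mod 4])%Z ->
         a n = 0].
Arguments S_plus : clear implicits.

Definition old_half (R : realType) (k N : nat) : set (R[i] -> R[i]) :=
  span ([set h | exists p, [/\ prime p, (p %| N)%N &
                   (S_half R k (N %/ p) `|`
                    image_U (p ^ 2) (S_half R k (N %/ p))) h]]
        `|` S_plus R k N `|` image_U 4 (S_plus R k N)).
Arguments old_half : clear implicits.

Definition S_half_new (R : realType) (k N : nat) : set (R[i] -> R[i]) :=
  orth_compl (k%:R + 2^-1) (4 * N) (S_half R k N) (old_half R k N).
Arguments S_half_new : clear implicits.

(* The action of T_{p^2} on Fourier coefficients, for p prime to 2N. *)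
Definition hecke_half (R : realType) (k p : nat) (a : nat -> R[i]) (n : nat) :
    R[i] :=
  a (p ^ 2 * n)%N
  + (legendre ((-1) ^+ k * n%:Z) p)%:~R * (p ^ k.-1)%:R * a n
  + (if (p ^ 2 %| n)%N then (p ^ (2 * k).-1)%:R * a (n %/ p ^ 2)%N else 0).

Definition half_eigenform (R : realType) (k N : nat) (f : R[i] -> R[i])
    (a : nat -> R[i]) : Prop :=
  [/\ q_expansion a f, ~ {in upper, f =1 fun=> 0} &
     forall p, prime p -> ~~ (p %| 2 * N)%N ->
       exists lambda : R[i], forall n, (0 < n)%N ->
         hecke_half k p a n = lambda * a n].

Definition cusp_int (R : realType) (kappa M : nat) : set (R[i] -> R[i]) :=
  [set f | [/\ holomorphic_upper f,
     forall g, Gamma0 M g -> forall z, z \in upper ->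
       f (mobius g z) = denom g z ^+ kappa * f z &
     vanishes_at_cusps (2 * kappa) f]].
Arguments cusp_int : clear implicits.

Definition old_int (R : realType) (kappa M : nat) : set (R[i] -> R[i]) :=
  span [set h | exists M' d f, [/\ (d * M' %| M)%N, M' != M,
                  cusp_int R kappa M' f & h = fun z => f (d%:R * z)]].
Arguments old_int : clear implicits.

Definition S_int_new (R : realType) (kappa M : nat) : set (R[i] -> R[i]) :=
  orth_compl kappa%:R M (cusp_int R kappa M) (old_int R kappa M).
Arguments S_int_new : clear implicits.

(* The action of T_p on Fourier coefficients, for p prime to the level. *)
Definition hecke_int (R : realType) (kappa p : nat) (A : nat -> R[i])
    (n : nat) : R[i] :=
  A (p * n)%N
  + (if (p %| n)%N then (p ^ kappa.-1)%:R * A (n %/ p)%N else 0).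

Definition int_eigenform (R : realType) (kappa M : nat) (F : R[i] -> R[i])
    (A : nat -> R[i]) : Prop :=
  [/\ q_expansion A F, ~ {in upper, F =1 fun=> 0} &
     forall p, prime p -> ~~ (p %| M)%N ->
       exists lambda : R[i], forall n, (0 < n)%N ->
         hecke_int kappa p A n = lambda * A n].

Definition is_twist_of (R : realType) (B A : nat -> R[i]) : Prop :=
  exists m (chi : int -> R[i]), dirichlet_character m chi /\
    forall n, (0 < n)%N -> B n = chi n%:Z * A n.

Definition shimura_lift (R : realType) (k N t : nat) (a : nat -> R[i])
    (n : nat) : R[i] :=
  \sum_(d <- divisors n | coprime d (2 * N))
    (jacobi ((-1) ^+ k * t%:Z) d)%:~R * (d ^ k.-1)%:R
    * a ((t * n ^ 2) %/ d ^ 2)%N.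

Definition sato_tate (R : realType) (I : set R) : R :=
  \int[lebesgue_measure]_(u in I `&` `[-1, 1])
    (2 / pi * Num.sqrt (1 - u ^+ 2)).

Definition has_natural_density (R : realType) (S : set nat) (delta : R) :=
  (fun x : nat =>
     #|[set p : 'I_x.+1 | prime p && (val p \in S)]|%:R
     / #|[set p : 'I_x.+1 | prime p]|%:R : R) @ \oo --> delta.

(* c / (2 p^(k - 1/2)) is real and lies in I. *)
Definition normalized_in (R : realType) (k p : nat) (c : R[i]) (I : set R) :=
  exists2 u : R, I u & c / (2 * p%:R `^ (k%:R - 2^-1))%:C = u%:C.

Definition pair_sato_tate (R : realType) (k1 N1 : nat) (A : nat -> R[i])
    (k2 N2 : nat) (B : nat -> R[i]) : Prop :=
  forall J1 J2 : interval R,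
    [set` J1] `<=` `[-1, 1] -> [set` J2] `<=` `[-1, 1] ->
    has_natural_density
      [set p | [/\ prime p, ~~ (p %| 2 * N1 * N2)%N,
         normalized_in k1 p (A p) [set` J1] &
         normalized_in k2 p (B p) [set` J2]]]
      (sato_tate [set` J1] * sato_tate [set` J2]).

(* Main.v *)
(* Up to a factor 2 p^(k - 1/2), the numbers A(p) and a(t p^2) differ by
   +-p^(k-1) a(t), that is by O(p^(-1/2)) after normalization.  Hence, outside
   finitely many p, the set for I1 x I2 lies between the Sato-Tate sets of F
   and G for slightly smaller and slightly larger intervals, and the Sato-Tate
   measure depends continuously on the end points.  Since no bound on A(p) is
   assumed, the upper estimate also uses that the primes with both normalized
   coefficients in [-1, 1] have density 1, which is the conjecture for
   J1 = J2 = [-1, 1] together with the total mass 1 of the measure. *)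

Require Import Defs.
From HB Require Import structures.
From mathcomp Require Import all_boot all_order all_algebra.
From mathcomp Require Import all_classical all_reals all_analysis.
From mathcomp Require Import complex zify ring lra.

Set Implicit Arguments.
Unset Strict Implicit.
Unset Printing Implicit Defensive.

Import Order.TTheory GRing.Theory Num.Theory numFieldNormedType.Exports.

Local Open Scope classical_set_scope.
Local Open Scope complex_scope.
Local Open Scope ring_scope.

(** * The semicircle density and its primitive *)

(** [asin] inverts [sin], which is continuous on the segment from -pi/2 to pi/2. The end points -1
    and 1, where [asin] is not differentiable, are needed for integrals over all of [-1, 1]. *)
Lemma asin_within_continuous (R : realType) :
  {within `[-1, 1]%classic, continuous (@asin R)}.
Proof.
rewrite -(@sin_pihalf R) -sinN; apply: segment_can_le_continuous.
- by rewrite -subr_ge0 opprK -splitr pi_ge0.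
- by apply: continuous_subspaceT => x; exact: continuous_sin.
- exact: sinK.
Qed.

Definition semicircle (R : realType) (u : R) : R :=
  2 / pi * Num.sqrt (1 - u ^+ 2).

(** The classical antiderivative of the density; the 1/2 from integrating the square root cancels
    the factor 2. *)
Definition semicircle_primitive (R : realType) (u : R) : R :=
  (asin u + u * Num.sqrt (1 - u ^+ 2)) / pi.

(** No restriction to [-1, 1] is made, because [Num.sqrt] is 0 at negative arguments. *)
Lemma sqrt_circle_continuous (R : realType) :
  continuous (fun u : R => Num.sqrt (1 - u ^+ 2)).
Proof.
move=> x; apply: (continuous_comp (f := fun u : R => 1 - u ^+ 2)).
  by apply: cvgB; [exact: cvg_cst|exact: exprn_continuous].
exact: sqrt_continuous.
Qed.

Lemma semicircle_continuous (R : realType) : continuous (@semicircle R).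
Proof.
by move=> x; apply: cvgM; [exact: cvg_cst|exact: sqrt_circle_continuous].
Qed.

Lemma semicircle_primitive_continuous (R : realType) :
  {within `[-1, 1]%classic, continuous (@semicircle_primitive R)}.
Proof.
move=> x; apply: cvgM; last exact: cvg_cst.
apply: cvgD; first exact: asin_within_continuous.
apply: (continuous_subspaceT (f := fun u : R => u * Num.sqrt (1 - u ^+ 2))).
by move=> u; apply: cvgM; [exact: cvg_id|exact: sqrt_circle_continuous].
Qed.

Lemma is_derive_semicircle_primitive (R : realType) (u : R) : -1 < u < 1 ->
  is_derive u 1 (@semicircle_primitive R) (semicircle u).
Proof.
move=> /andP[u1 u2]; have h : 0 < 1 - u ^+ 2 by nra.
have d1 := @is_derive1_asin R u (introT andP (conj u1 u2)).
have d2 : is_derive u 1 (fun x : R => 1 - x ^+ 2) (- (2 * u)).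
  apply: is_derive_eq; rewrite /GRing.scale/=; ring.
have d3 := @is_derive1_sqrt R _ h.
have d4 : is_derive u 1 (fun x : R => Num.sqrt (1 - x ^+ 2))
    ((2 * Num.sqrt (1 - u ^+ 2))^-1 * (- (2 * u))).
  exact: (@is_derive1_comp _ Num.sqrt (fun x : R => 1 - x ^+ 2)).
rewrite /semicircle_primitive.
apply: is_derive_eq.
rewrite /GRing.scale/= /semicircle.
have s0 : Num.sqrt (1 - u ^+ 2) != 0 by rewrite gt_eqF// sqrtr_gt0.
have p0 : (pi : R) != 0 by rewrite gt_eqF// pi_gt0.
have hs : Num.sqrt (1 - u ^+ 2) ^+ 2 = 1 - u ^+ 2 by rewrite sqr_sqrtr// ltW.
move: (Num.sqrt (1 - u ^+ 2) : R) s0 hs => s s0 hs.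
move: (pi : R) p0 => c c0.
(* The derivative is the sum of 1/s, s and -u^2/s, divided by c = pi; by s^2 = 1 - u^2 the sum is
   2s. *)
transitivity ((1 - u ^+ 2 + s ^+ 2) / (s * c)).
  by field; rewrite c0 s0.
by rewrite -hs; field; rewrite c0 s0.
Qed.

Lemma semicircle_integrable (R : realType) (c d : R) :
  (@lebesgue_measure R).-integrable `[c, d]%classic
    (EFin \o @semicircle R).
Proof.
apply: continuous_compact_integrable; first exact: segment_compact.
by apply: continuous_subspaceT; exact: semicircle_continuous.
Qed.

Lemma semicircle_ge0 (R : realType) (u : R) : 0 <= semicircle u.
Proof. by rewrite mulr_ge0 ?sqrtr_ge0// divr_ge0 ?pi_ge0. Qed.

Lemma semicircle_le1 (R : realType) (u : R) : semicircle u <= 1.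
Proof.
rewrite mulr_ile1 ?sqrtr_ge0 ?divr_ge0 ?pi_ge0//.
  by rewrite ler_pdivrMr ?pi_gt0// mul1r pi_ge2.
by rewrite -[leRHS]sqrtr1 ler_wsqrtr// gerBl sqr_ge0.
Qed.

(** Fundamental theorem of calculus: at [c] and [d] it asks only for continuity of the primitive, so
    -1 and 1 are allowed. It requires c < d, hence the separate case c = d. *)
Lemma integral_semicircle (R : realType) (c d : R) :
  -1 <= c -> c <= d -> d <= 1 ->
  \int[lebesgue_measure]_(u in `[c, d]) semicircle u =
  semicircle_primitive d - semicircle_primitive c.
Proof.
move=> c1; rewrite le_eqVlt => /predU1P[<- _|cd d1].
  by rewrite set_itv1 Rintegral_set1 subrr.
rewrite /Rintegral (@continuous_FTC2 _ _ (@semicircle_primitive R))//.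
- by apply: continuous_subspaceT; exact: semicircle_continuous.
- have sub : `[c, d]%classic `<=` `[-1, 1]%classic.
    move=> x /=; rewrite !in_itv/= => /andP[cx xd].
    by rewrite (le_trans c1)// (le_trans xd).
  have := continuous_subspaceW sub (@semicircle_primitive_continuous R).
  move=> /(continuous_within_itvP _ cd)[_ Hc Hd]; split=> // x.
  rewrite in_itv/= => /andP[cx xd].
  apply: (@ex_derive _ _ _ _ _ _ (semicircle x)).
  apply: is_derive_semicircle_primitive.
  by rewrite (le_lt_trans c1)// (lt_le_trans xd).
- move=> x; rewrite in_itv/= => /andP[cx xd]; rewrite derive1E.
  apply: (@derive_val _ _ _ _ _ _ (semicircle x)).
  apply: is_derive_semicircle_primitive.
  by rewrite (le_lt_trans c1)// (lt_le_trans xd).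
Qed.

Lemma semicircle_primitive_homo (R : realType) (c d : R) :
  -1 <= c -> c <= d -> d <= 1 ->
  semicircle_primitive c <= semicircle_primitive d.
Proof.
move=> c1 cd d1; rewrite -subr_ge0 -integral_semicircle//.
by apply: Rintegral_ge0 => x _; exact: semicircle_ge0.
Qed.

(** The density is at most 1 because pi >= 2. This bounds the effect of moving an end point,
    uniformly up to -1 and 1. *)
Lemma semicircle_primitive_lipschitz (R : realType) (c d : R) :
  -1 <= c -> c <= d -> d <= 1 ->
  semicircle_primitive d - semicircle_primitive c <= d - c.
Proof.
move=> c1 cd d1; rewrite -integral_semicircle//.
have mE : lebesgue_measure (`[c, d]%classic : set R) = (d - c)%:E.
  rewrite lebesgue_measure_itv/= lte_fin.
  by case: ltgtP cd => //= -> _; rewrite subrr.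
have -> : d - c = \int[lebesgue_measure]_(u in `[c, d]) (1 : R).
  by rewrite Rintegral_cst// mul1r; exact: (esym (congr1 fine mE)).
apply: le_Rintegral => //.
- exact: semicircle_integrable.
- apply: continuous_compact_integrable; first exact: segment_compact.
  by apply: continuous_subspaceT => x; exact: cvg_cst.
- by move=> x _; exact: semicircle_le1.
Qed.

(** The square roots vanish at both ends, leaving (asin 1 - asin (-1)) / pi. This is the total mass
    of the measure. *)
Lemma semicircle_primitive_pm1 (R : realType) :
  semicircle_primitive 1 - semicircle_primitive (-1) = 1 :> R.
Proof.
rewrite /semicircle_primitive sqrrN expr1n subrr sqrtr0 !mulr0 !addr0.
have p2 : pi / 2 \in `[- (pi / 2) : R, pi / 2].
  by rewrite in_itv/= lexx -subr_ge0 opprK -splitr pi_ge0.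
have m2 : - (pi / 2) \in `[- (pi / 2) : R, pi / 2].
  by rewrite in_itv/= lexx -subr_ge0 opprK -splitr pi_ge0.
have -> : asin (1 : R) = pi / 2 by rewrite -[in LHS](@sin_pihalf R) sinK.
have -> : asin (-1 : R) = - (pi / 2).
  by rewrite -[in LHS](@sin_pihalf R) -sinN sinK.
by rewrite -mulrBl opprK -splitr divff// gt_eqF// pi_gt0.
Qed.

(** * The Sato-Tate measure of intervals *)

(** A nonempty interval inside [-1, 1] must have finite end points in [-1, 1], and single points
    have measure zero, so the kind of each end does not matter. *)
Lemma sato_tate_itv (R : realType) (I : interval R) :
  [set` I] `<=` `[-1, 1]%classic -> [set` I] !=set0 ->
  exists l r : R, [/\ -1 <= l, l <= r, r <= 1,
    `]l, r[%classic `<=` [set` I] /\ [set` I] `<=` `[l, r]%classic &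
    sato_tate [set` I] = semicircle_primitive r - semicircle_primitive l].
Proof.
move=> I1 [x Ix].
have oI (a b : bool) (l r : R) :
    [set` Interval (BSide a l) (BSide b r)] `<=` `[l, r]%classic.
  move=> y /=; rewrite !in_itv/= => /andP[].
  by case: a; case: b => /= h1 h2; rewrite ?h1 ?h2 ?(ltW h1) ?(ltW h2).
have Io (a b : bool) (l r : R) :
    `]l, r[%classic `<=` [set` Interval (BSide a l) (BSide b r)].
  move=> y /=; rewrite !in_itv/= => /andP[h1 h2].
  by case: a; case: b => /=; rewrite ?h1 ?h2 ?(ltW h1) ?(ltW h2).
have stE : sato_tate [set` I] =
    \int[lebesgue_measure]_(u in [set` I]) semicircle u.
  by rewrite /sato_tate setIidl.
have {}I1 y : y \in I -> -1 <= y <= 1 by move=> /I1; rewrite /= in_itv.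
have {}Ix : x \in I by [].
have /andP[x1 x2] := I1 _ Ix.
case: I I1 Ix stE => -[a l|a] J I1 Ix stE;
  move: Ix; rewrite itv_boundlr => /andP[lx xr]; last first.
  (* An interval unbounded below would contain this point, which is less than -1. *)
  exfalso; have := I1 (Order.min x (-2)); rewrite itv_boundlr.
  case: a lx {stE I1} => //= _.
  rewrite (le_trans _ xr) ?bnd_simp ?ge_min ?lexx// => /(_ isT)/andP[+ _].
  by rewrite le_min => /andP[_]; lra.
case: J I1 xr stE => [b r|b] I1 xr stE; last first.
  exfalso; have := I1 (Order.max x 2); rewrite itv_boundlr.
  case: b xr {stE I1} => //= _.
  rewrite (le_trans lx) ?bnd_simp ?le_max ?lexx// => /(_ isT)/andP[_].
  by rewrite ge_max => /andP[_]; lra.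
have xlr : l <= x <= r.
  by have := @oI a b l r x; rewrite /= in_itv; apply; exact/andP.
have l1 : -1 <= l.
  rewrite leNgt; apply/negP => l1.
  (* The midpoint of [l] and -1 would lie in [I] but to the left of -1. *)
  have := I1 ((l - 1) / 2); rewrite itv_boundlr.
  rewrite (le_trans _ xr) ?bnd_simp; last by lra.
  have -> : (BSide a l <= BLeft ((l - 1) / 2))%O.
    by case: (a); rewrite bnd_simp; lra.
  by move=> /(_ isT)/andP[+ _]; lra.
have r1 : r <= 1.
  rewrite leNgt; apply/negP => r1.
  have := I1 ((r + 1) / 2); rewrite itv_boundlr.
  rewrite (le_trans lx) ?bnd_simp; last by lra.
  have -> : (BRight ((r + 1) / 2) <= BSide b r)%O.
    by case: (b); rewrite bnd_simp; lra.
  by move=> /(_ isT)/andP[_]; lra.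
have lr : l <= r by case/andP: xlr; exact: le_trans.
exists l, r; split=> //.
have ic (c d : bool) : (@lebesgue_measure R).-integrable
    [set` Interval (BSide c l) (BSide d r)] (EFin \o @semicircle R).
  by apply: integrableS (semicircle_integrable l r) => //; exact: oI.
rewrite stE -integral_semicircle//.
case: a b {I1 lx xr stE} => -[].
- exact: Rintegral_itv_bndo_bndc.
- by [].
- by rewrite Rintegral_itv_bndo_bndc// Rintegral_itv_obnd_cbnd.
- exact: Rintegral_itv_obnd_cbnd.
Qed.

Lemma sato_tate_segment (R : realType) (c d : R) :
  -1 <= c -> c <= d -> d <= 1 ->
  sato_tate `[c, d]%classic = semicircle_primitive d - semicircle_primitive c.
Proof.
move=> c1 cd d1; rewrite -integral_semicircle// /sato_tate setIidl//.
move=> x /=; rewrite !in_itv/= => /andP[cx xd].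
by rewrite (le_trans c1)// (le_trans xd).
Qed.

Lemma sato_tate_pm1 (R : realType) : sato_tate `[-1, 1]%classic = 1 :> R.
Proof. by rewrite sato_tate_segment ?semicircle_primitive_pm1//; lra. Qed.

Lemma sato_tate_set0 (R : realType) : sato_tate set0 = 0 :> R.
Proof. by rewrite /sato_tate set0I Rintegral_set0. Qed.

(** [J] is [I] shrunk by [e] at both ends, [K] is [I] enlarged by [e] and cut to [-1, 1], since the
    conjecture speaks only of subintervals of [-1, 1]. Four pieces of length at most [e] separate
    them, whence 4 * e by the Lipschitz bound. *)
Lemma sato_tate_sandwich (R : realType) (e : R) (I : interval R) : 0 < e ->
  [set` I] `<=` `[-1, 1]%classic ->
  exists J K : interval R,
    [/\ [set` J] `<=` `[-1, 1]%classic, [set` K] `<=` `[-1, 1]%classic,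
        (forall u v, `|u - v| < e -> [set` J] u -> [set` I] v),
        (forall u v, `|u - v| < e -> [set` I] u -> `[-1, 1]%classic v ->
           [set` K] v) &
        [/\ 0 <= sato_tate [set` J], sato_tate [set` J] <= sato_tate [set` I],
            sato_tate [set` I] <= sato_tate [set` K], sato_tate [set` K] <= 1 &
            sato_tate [set` K] <= sato_tate [set` J] + 4 * e]].
Proof.
move=> e0 I1; have [I0|/set0P/(sato_tate_itv I1)] := eqVneq [set` I] set0.
  (* []0, 0[] encodes the empty interval. *)
  exists `]0, 0[, `]0, 0[; rewrite I0 set_itvoo0 sato_tate_set0.
  split=> //; split=> //; lra.
move=> [l [r [l1 lr r1 [olr clr] ->]]].
pose c := Order.max (-1) (l - e); pose d := Order.min 1 (r + e).
have c1 : -1 <= c by rewrite le_max lexx.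
have d1 : d <= 1 by rewrite ge_min lexx.
have cl : c <= l by rewrite ge_max l1/=; lra.
have rd : r <= d by rewrite le_min r1/=; lra.
have ce : l - e <= c by rewrite le_max lexx orbT.
have de : d <= r + e by rewrite ge_min lexx orbT.
have := semicircle_primitive_homo c1 cl (le_trans lr r1).
have := semicircle_primitive_lipschitz c1 cl (le_trans lr r1).
have := semicircle_primitive_homo (le_trans l1 lr) rd d1.
have := semicircle_primitive_lipschitz (le_trans l1 lr) rd d1.
have := semicircle_primitive_homo (lexx _) c1 (le_trans cl (le_trans lr r1)).
have := semicircle_primitive_homo (le_trans l1 (le_trans lr rd)) d1 (lexx _).
have := semicircle_primitive_pm1 R.
have := semicircle_primitive_homo l1 lr r1.
have := semicircle_primitive_lipschitz l1 lr r1.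
have sK := sato_tate_segment c1 (le_trans cl (le_trans lr rd)) d1.
have K1 : [set` `[c, d]] `<=` `[-1, 1]%classic.
  by move=> x /=; rewrite !in_itv/= => /andP[? ?]; lra.
have KI u v : `|u - v| < e -> [set` I] u -> `[-1, 1]%classic v ->
    [set` `[c, d]] v.
  move=> uv /clr/=; rewrite !in_itv/= /c /d ge_max le_min.
  move: uv; rewrite ltr_norml; lra.
have [ler|ler] := leP (l + e) (r - e).
  have := @semicircle_primitive_lipschitz R l (l + e) l1.
  have := @semicircle_primitive_homo R l (l + e) l1.
  have := @semicircle_primitive_lipschitz R (r - e) r _ _ r1.
  have := @semicircle_primitive_homo R (r - e) r _ _ r1.
  have := @semicircle_primitive_homo R (l + e) (r - e) _ ler.
  have sJ : sato_tate [set` `[l + e, r - e]] =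
      semicircle_primitive (r - e) - semicircle_primitive (l + e).
    by apply: sato_tate_segment => //; lra.
  have [? [? ?]] : -1 <= r - e /\ l + e <= 1 /\ -1 <= l + e by split; lra.
  move=> H1 H2 H3 H4 H5 *; exists `[l + e, r - e], `[c, d]; split=> //.
  - by move=> x /=; rewrite !in_itv/= => /andP[? ?]; lra.
  (* The strict bound on |u - v| puts [v] in the open interval from [l] to [r], whatever the kind of
     the ends of [I]. *)
  - move=> u v uv /=; rewrite in_itv/= => uI; apply: olr; rewrite /= in_itv/=.
    by move: uv uI; rewrite ltr_norml; lra.
  - rewrite sJ sK; have := H1; have := H2; have := H3.
    by have := H4; have := H5; split; lra.
(* Here r - l < 2e: [J] is empty and [K] is shorter than 4e. *)
move=> *; exists `]0, 0[, `[c, d]; split=> //; rewrite set_itvoo0//.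
  by rewrite sato_tate_set0 sK; split; lra.
Qed.

(** * Prime counting and natural densities *)

(** A sum of indicators, so that relations between sets become inequalities term by term;
    [prime_count setT x] is pi(x). *)
Definition prime_count (S : set nat) (x : nat) : nat :=
  (\sum_(p < x.+1 | prime p) (val p \in S))%N.

Lemma card_classical_set (T : finType) (b : pred T) :
  #|[set x | b x]%classic| = (\sum_(x | b x) 1)%N.
Proof.
by rewrite -sum1_card; apply: eq_bigl => x; apply/idP/idP; rewrite inE.
Qed.

Lemma has_natural_densityE (R : realType) (S : set nat) (delta : R) :
  has_natural_density S delta =
  ((fun x => (prime_count S x)%:R / (prime_count setT x)%:R : R) @ \oo
     --> delta).
Proof.
rewrite /has_natural_density; set u := (X in X @ _ --> _).
set v := (X in _ = (X @ _ --> _)); suff -> : u = v by [].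
apply/funext => x; rewrite /u /v.
rewrite !card_classical_set /prime_count; congr (_%:R / _%:R).
  by rewrite big_mkcondr; apply: eq_bigr => p _; case: (_ \in _).
by apply: eq_bigr => p _; rewrite in_setT.
Qed.

Lemma sum_ltn_ord (m x : nat) :
  (\sum_(p < x | prime p) (p < m) <= m)%N.
Proof.
apply: (@leq_trans (\sum_(p < x) (p < m))).
  by rewrite [leqRHS](bigID (fun p : 'I_x => prime p))/= leq_addr.
suff -> : (\sum_(p < x) (p < m) = minn m x)%N by exact: geq_minl.
elim: x => [|x IH]; first by rewrite big_ord0 minn0.
by rewrite big_ord_recr/= IH; lia.
Qed.

(** Sum the indicator inequality over primes; each prime below [m] costs at most 2. Two sets on each
    side allow S [&] T [<=] U to be used as 1_S + 1_T <= 1_U + 1. *)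
Lemma leq_prime_countD (S T U V : set nat) (m x : nat) :
  (forall p, prime p -> (m <= p)%N ->
    ((p \in S) + (p \in T) <= (p \in U) + (p \in V))%N) ->
  (prime_count S x + prime_count T x <=
   prime_count U x + prime_count V x + m.*2)%N.
Proof.
move=> H; apply: (@leq_trans (prime_count U x + prime_count V x +
    \sum_(p < x.+1 | prime p) (p < m).*2)%N); last first.
  rewrite leq_add2l (eq_bigr (fun p : 'I_x.+1 => (p < m) + (p < m))%N).
    by rewrite big_split/= addnn leq_double sum_ltn_ord.
  by move=> p _; rewrite addnn.
rewrite /prime_count -!big_split/=; apply: leq_sum => p pp.
have [mp|pm] := leqP m p; first by rewrite addn0 H.
by rewrite (leq_trans _ (leq_addl _ _))// (leq_add (leq_b1 _) (leq_b1 _)).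
Qed.

(** Euclid: the count is monotone, and a prime beyond [m] raises it by one. *)
Lemma prime_count_unbounded (n : nat) :
  exists m, forall x, (m <= x)%N -> (n <= prime_count setT x)%N.
Proof.
have E x : prime_count setT x = (\sum_(0 <= p < x.+1 | prime p) 1)%N.
  by rewrite /prime_count big_mkord; apply: eq_bigr => p _; rewrite in_setT.
have mono : {homo prime_count setT : x y / (x <= y)%N}.
  by move=> x y xy; rewrite !E [leqRHS](big_cat_nat (n := x.+1))//= leq_addr.
elim: n => [|n [m hm]]; first by exists 0%N.
have [p mp pp] := prime_above m; exists p => x px.
apply: leq_trans (mono _ _ px); case: p mp pp {px} => // p mp pp.
by rewrite E big_mkcond big_nat_recr//= pp addn1 ltnS -big_mkcond/= -E hm.
Qed.

Lemma prime_count_ratio_cvg0 (R : realType) (m : nat) :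
  (fun x => m%:R / (prime_count setT x)%:R : R) @ \oo --> (0 : R).
Proof.
apply/cvgrPdist_lt => e e0.
have [n hn] := prime_count_unbounded (Num.trunc (m%:R / e)).+1.
exists n => // x /hn nx; rewrite sub0r normrN ger0_norm ?divr_ge0//.
rewrite ltr_pdivrMr ?ltr0n; last exact: leq_trans nx.
rewrite mulrC -ltr_pdivrMr// (lt_le_trans (truncnS_gt _))//.
by rewrite ler_nat.
Qed.

(** Up to finitely many primes, [S] contains [L], and its part in [T] lies in [U]. As [T] has
    density 1, what [S] has outside [T] is negligible. *)
Lemma has_natural_density_squeeze (R : realType) (S : set nat) (delta : R) :
  (forall eta : R, 0 < eta -> exists (L U T : set nat) (l u : R) (m : nat),
    [/\ has_natural_density L l, has_natural_density U u,
        has_natural_density T (1 : R),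
        delta - eta <= l /\ u <= delta + eta &
        forall p, prime p -> (m <= p)%N ->
          (L p -> S p) /\ (S p -> T p -> U p)]) ->
  has_natural_density S delta.
Proof.
move=> H; rewrite has_natural_densityE; apply/cvgrPdist_lt => e e0.
(* The upper estimate adds four errors: the gap between [u] and [delta], the ratios of [U] and of
   [T], and the primes below [m]. Each is at most e / 5. *)
have e5 : 0 < e / 5 by rewrite divr_gt0.
have [L [U [T [l [u [m [dL dU dT [lb ub] LSU]]]]]]] := H _ e5.
move: dL dU dT (@prime_count_ratio_cvg0 R m.*2); rewrite !has_natural_densityE.
move=> /cvgrPdist_lt/(_ _ e5) hL /cvgrPdist_lt/(_ _ e5) hU.
move=> /cvgrPdist_lt/(_ _ e5) hT /cvgrPdist_lt/(_ _ e5) h0.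
near=> x.
(* The empty set only fills the second slot of the two-set inequality. *)
have lower : (prime_count L x + prime_count set0 x <=
    prime_count S x + prime_count set0 x + m.*2)%N.
  apply: leq_prime_countD => p pp mp; rewrite in_set0 !addn0.
  case: (boolP (p \in L)) => //; rewrite inE => /(LSU p pp mp).1 Sp.
  by rewrite (mem_set Sp).
have upper : (prime_count S x + prime_count T x <=
    prime_count U x + prime_count setT x + m.*2)%N.
  apply: leq_prime_countD => p pp mp; rewrite in_setT.
  case: (boolP (p \in S)) => [/set_mem Sp|_]; last first.
    by rewrite add0n (leq_trans (leq_b1 _))// leq_addl.
  case: (boolP (p \in T)) => [/set_mem Tp|_]; last by rewrite addn0 leq_addl.
  by rewrite (mem_set ((LSU p pp mp).2 Sp Tp)).
have : `|l - (prime_count L x)%:R / (prime_count setT x)%:R| < e / 5.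
  by near: x.
have : `|u - (prime_count U x)%:R / (prime_count setT x)%:R| < e / 5.
  by near: x.
have : `|1 - (prime_count T x)%:R / (prime_count setT x)%:R| < e / 5.
  by near: x.
have : `|0 - m.*2%:R / (prime_count setT x)%:R| < e / 5.
  by near: x.
have pi1 : (0 < prime_count setT x)%N.
  near: x; have [n hn] := prime_count_unbounded 1.
  by exists n => // x /hn.
have c0 : prime_count set0 x = 0%N.
  by rewrite /prime_count big1// => p _; rewrite in_set0.
move: lower upper; rewrite c0 !addn0 -2!(ler_nat R) !natrD.
move: pi1; rewrite -(ltr_nat R).
move: (prime_count L x)%:R (prime_count S x)%:R (prime_count T x)%:R.
move: (prime_count U x)%:R (prime_count setT x)%:R (m.*2%:R) => cU cP cm.
move=> cL cS cT cP0.
rewrite -(ler_pM2r (x := cP^-1)) ?invr_gt0// mulrDl => lower.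
rewrite -(ler_pM2r (x := cP^-1)) ?invr_gt0// !mulrDl divff ?gt_eqF// => upper.
by rewrite !ltr_norml => /andP[? ?] /andP[? ?] /andP[? ?] /andP[? ?]; lra.
Unshelve. all: by end_near.
Qed.

(** * The Shimura lift at primes and its normalization *)

Lemma divisors_prime (p : nat) : prime p -> perm_eq (divisors p) [:: 1; p]%N.
Proof.
move=> pp; have p1 := prime_gt1 pp; apply: uniq_perm.
- exact: divisors_uniq.
- by rewrite /= inE andbT neq_ltn p1.
- move=> d; rewrite -dvdn_divisors ?prime_gt0// !inE.
  apply/idP/idP => [|/orP[]/eqP->//]; exact: (primeP pp).2.
Qed.

Lemma jacobi_prime (a : int) (p : nat) : prime p -> jacobi a p = legendre a p.
Proof.
by move=> pp; rewrite /jacobi primes_prime// big_seq1 lognE pp dvdnn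
  prime_gt0//= divnn prime_gt0//= logn1.
Qed.

(** Both divisors 1 and p of p are prime to 2N: d = 1 gives the first term, d = p the second. *)
Lemma shimura_lift_prime (R : realType) (k N t p : nat) (a : nat -> R[i]) :
  prime p -> ~~ (p %| 2 * N)%N ->
  shimura_lift k N t a p =
  a (t * p ^ 2)%N
  + (legendre ((-1) ^+ k * t%:Z) p)%:~R * (p ^ k.-1)%:R * a t.
Proof.
move=> pp pN; rewrite /shimura_lift (perm_big _ (divisors_prime pp))/=.
rewrite big_cons coprime1n big_cons big_nil prime_coprime// pN addr0.
rewrite (jacobi_prime _ pp) !exp1n divn1 mulnK ?expn_gt0 ?prime_gt0//.
by rewrite /jacobi /= big_nil !mul1r.
Qed.

Lemma normr_legendre (a : int) (p : nat) : `|legendre a p| <= 1.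
Proof. by rewrite /legendre; case: ifP => // _; case: ifP. Qed.

(** The second term of A(p), once normalized, is a sign or 0 times p^(k-1) / (2 p^(k-1/2)) = 1 / (2
    sqrt p). Its being real lets it shift the real number behind [normalized_in]. *)
Lemma normalized_shimura_lift (R : realType) (k N t p : nat) (a : nat -> R[i]) :
  (1 <= k)%N -> prime p -> ~~ (p %| 2 * N)%N -> a t = 1 ->
  exists2 delta : R, `|delta| <= (Num.sqrt p%:R)^-1 &
    let D := (2 * p%:R `^ (k%:R - 2^-1))%:C in
    shimura_lift k N t a p / D = a (t * p ^ 2)%N / D + delta%:C.
Proof.
move=> k1 pp pN at1; have p0 : 0 < p%:R :> R by rewrite ltr0n prime_gt0.
exists ((legendre ((-1) ^+ k * t%:Z) p)%:~R * (p ^ k.-1)%:R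
  / (2 * p%:R `^ (k%:R - 2^-1))).
  (* The truncated [k.-1] is the true k - 1 because k >= 1. *)
  have -> : p%:R `^ (k%:R - 2^-1) = (p ^ k.-1)%:R * Num.sqrt p%:R :> R.
    rewrite -powR12_sqrt ?ltW// natrX -powR_mulrn ?ltW// -powRD; last first.
      by rewrite (gt_eqF p0) implybT.
    by congr (_ `^ _); rewrite -[in LHS](prednK k1) -natr1; lra.
  have q0 : 0 < (p ^ k.-1)%:R :> R by rewrite ltr0n expn_gt0 prime_gt0.
  have s0 : 0 < Num.sqrt p%:R :> R by rewrite sqrtr_gt0.
  rewrite [X in `|X|](_ : _ =
    (legendre ((-1) ^+ k * t%:Z) p)%:~R * (2^-1 * (Num.sqrt p%:R)^-1));
    last first.
    by field; rewrite !gt_eqF.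
  have h0 : 0 <= 2^-1 * (Num.sqrt p%:R)^-1 :> R.
    by rewrite mulr_ge0// invr_ge0 ltW.
  rewrite normrM (ger0_norm h0) -[leRHS]mul1r ler_pM//; last first.
    by rewrite ler_piMl ?invr_ge0 ?(ltW s0)// invf_le1// ler1n.
  by rewrite -intr_norm -[leRHS]/(1%:~R) ler_int normr_legendre.
rewrite /= (shimura_lift_prime _ _ _ pp pN) at1 mulr1 mulrDl; congr (_ + _).
rewrite [RHS]rmorphM/= [in RHS]fmorphV [in RHS]rmorphM/=.
by rewrite rmorph_int rmorph_nat.
Qed.

Lemma sqrt_natr_inv_small (R : realType) (e : R) : 0 < e ->
  exists m, forall p, (0 < p)%N -> (m <= p)%N -> (Num.sqrt p%:R)^-1 < e.
Proof.
(* 1 / sqrt p < e amounts to p > e^-2. *)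
move=> e0; exists (Num.trunc (e ^- 2)).+1 => p p0 mp.
rewrite invf_plt ?posrE ?sqrtr_gt0 ?ltr0n//.
rewrite -[ltLHS]ger0_norm ?invr_ge0 ?(ltW e0)// -sqrtr_sqr ltr_sqrt ?ltr0n//.
by rewrite exprVn (lt_le_trans (truncnS_gt _))// ler_nat.
Qed.

(** Both normalized values differ by a real number smaller than [e]. The first direction serves the
    lower inclusion, the second the upper one. *)
Lemma normalized_in_shimura_lift (R : realType) (k N t p : nat)
    (a : nat -> R[i]) (e : R) (I J : set R) :
  (1 <= k)%N -> prime p -> ~~ (p %| 2 * N)%N -> a t = 1 ->
  (Num.sqrt p%:R)^-1 < e -> (forall u v, `|u - v| < e -> J u -> I v) ->
  (normalized_in k p (shimura_lift k N t a p) J ->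
   normalized_in k p (a (t * p ^ 2)%N) I) /\
  (normalized_in k p (a (t * p ^ 2)%N) J ->
   normalized_in k p (shimura_lift k N t a p) I).
Proof.
move=> k1 pp pN at1 pe JI.
have [delta de /= E] := normalized_shimura_lift k1 pp pN at1.
split=> -[u Ju Eu].
  exists (u - delta); last by rewrite rmorphB/= -Eu E addrK.
  by apply: JI Ju; rewrite opprB addrCA subrr addr0 (le_lt_trans de).
exists (u + delta); last by rewrite rmorphD/= -Eu E.
by apply: JI Ju; rewrite opprD addNKr normrN (le_lt_trans de).
Qed.

(** The embedding of [R] into [R[i]] is injective, so both memberships concern the same real
    number. *)
Lemma normalized_inI (R : realType) (k p : nat) (c : R[i]) (I J : set R) :
  normalized_in k p c I -> normalized_in k p c J ->
  normalized_in k p c (I `&` J).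
Proof.
move=> [u Iu uE] [v Jv]; rewrite uE => -[uv].
by exists u => //; split=> //; rewrite uv.
Qed.

(** * Transfer of the joint distribution from the lifts to f and g *)

Theorem theorem4p4 (R : realType) (k1 k2 N1 N2 t : nat)
    (f g F G : R[i] -> R[i]) (a b : nat -> R[i])
    (hk1 : (1 <= k1)%N) (hk2 : (1 <= k2)%N)
    (hN1 : odd N1) (hN1sf : square_free N1)
    (hN2 : odd N2) (hN2sf : square_free N2)
    (hf : S_half_new R k1 N1 f) (hg : S_half_new R k2 N2 g)
    (hfg : ~ {in upper, f =1 g})
    (hfe : half_eigenform k1 N1 f a) (hge : half_eigenform k2 N2 g b)
    (ht : square_free t) (hat : a t = 1) (hbt : b t = 1)
    (hF : S_int_new R (2 * k1) (2 * N1) F)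
    (hG : S_int_new R (2 * k2) (2 * N2) G)
    (hFe : int_eigenform (2 * k1) (2 * N1) F (shimura_lift k1 N1 t a))
    (hGe : int_eigenform (2 * k2) (2 * N2) G (shimura_lift k2 N2 t b))
    (hFG : ~ is_twist_of (shimura_lift k1 N1 t a) (shimura_lift k2 N2 t b))
    (hGF : ~ is_twist_of (shimura_lift k2 N2 t b) (shimura_lift k1 N1 t a))
    (hST : pair_sato_tate k1 N1 (shimura_lift k1 N1 t a)
                          k2 N2 (shimura_lift k2 N2 t b)) :
  forall I1 I2 : interval R,
    [set` I1] `<=` `[-1, 1] -> [set` I2] `<=` `[-1, 1] ->
    has_natural_density
      [set p | [/\ prime p, ~~ (p %| 4 * N1 * N2)%N,
         normalized_in k1 p (a (t * p ^ 2)%N) [set` I1] &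
         normalized_in k2 p (b (t * p ^ 2)%N) [set` I2]]]
      (sato_tate [set` I1] * sato_tate [set` I2]).
Proof.
move=> I1 I2 hI1 hI2; apply: has_natural_density_squeeze => eta eta0.
(* Each factor then moves by at most 4 * eta / 8 = eta / 2; as all measures lie in [0, 1], the
   products move by at most [eta]. *)
have e0 : 0 < eta / 8 by rewrite divr_gt0.
have [J1 [K1 [hJ1 hK1 JI1 IK1 [? ? ? ? ?]]]] := sato_tate_sandwich e0 hI1.
have [J2 [K2 [hJ2 hK2 JI2 IK2 [? ? ? ? ?]]]] := sato_tate_sandwich e0 hI2.
have [m hm] := sqrt_natr_inv_small e0.
pose S (X1 X2 : interval R) := [set p | [/\ prime p, ~~ (p %| 2 * N1 * N2)%N,
  normalized_in k1 p (shimura_lift k1 N1 t a p) [set` X1] &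
  normalized_in k2 p (shimura_lift k2 N2 t b p) [set` X2]]].
exists (S J1 J2), (S K1 K2), (S `[-1, 1] `[-1, 1]).
exists (sato_tate [set` J1] * sato_tate [set` J2]).
exists (sato_tate [set` K1] * sato_tate [set` K2]), m.
split.
- exact: hST.
- exact: hST.
- have := hST `[-1, 1] `[-1, 1]; rewrite sato_tate_pm1 mulr1; exact.
- by split; nra.
move=> p pp mp.
(* The levels 4 N1 N2 and 2 N1 N2 exclude the same primes. *)
have p4 : (p %| 4)%N = (p %| 2)%N by rewrite (Euclid_dvdX 2 2 pp) andbT.
have level : (p %| 4 * N1 * N2)%N = (p %| 2 * N1 * N2)%N.
  by rewrite !(Euclid_dvdM _ _ pp) p4.
have small := hm p (prime_gt0 pp) mp.
have ndvd : ~~ (p %| 2 * N1 * N2)%N ->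
    ~~ (p %| 2 * N1)%N /\ ~~ (p %| 2 * N2)%N.
  by rewrite !(Euclid_dvdM _ _ pp) !negb_or => /andP[/andP[-> ->] ->].
(* Enlarging [I] gives membership in [K] only for values in [-1, 1]. The implication is carried as a
   set and discharged by membership of p in the density-one set. *)
have meet k (c : R[i]) (K : set R) :
    normalized_in k p c [set v | `[-1, 1]%classic v -> K v] ->
    normalized_in k p c `[-1, 1]%classic -> normalized_in k p c K.
  by move=> h1 h2; have [u [/[apply] ? ?]] := normalized_inI h1 h2; exists u.
split=> -[_]; rewrite /= ?level => pN hA hB.
  have [pN1 pN2] := ndvd pN; split; rewrite ?level//.
    exact: (normalized_in_shimura_lift hk1 pp pN1 hat small JI1).1.
  exact: (normalized_in_shimura_lift hk2 pp pN2 hbt small JI2).1.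
have [pN1 pN2] := ndvd pN; move=> [_ _ tA tB]; split=> //.
  apply: meet tA.
  apply: (normalized_in_shimura_lift hk1 pp pN1 hat small _).2 hA.
  by move=> u v /IK1.
apply: meet tB.
apply: (normalized_in_shimura_lift hk2 pp pN2 hbt small _).2 hB.
by move=> u v /IK2.
Qed.
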